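(* Let $h\geq 1$ be an integer. Every planar poset $P$ of height $h$ that has a unique minimum element $0$ and a unique maximum element $1$ satisfies $\operatorname{qn}(P)\leq h-1$.
   Context: All posets are finite and nonempty. For elements $a,b$ of a poset $P$, write $a \prec b$ (a cover relation, or cover) if $a<b$ and there is no $c\in P$ with $a<c<b$. The height of $P$ is the maximum number of pairwise comparable elements. An element $0$ (respectively $1$) of $P$ is an element with $0\leq x$ (respectively $x\leq 1$) for all $x\in P$. A linear extension $L$ of $P$ is a linear order on the elements of $P$ such that $x<_L y$ whenever $x<_P y$. A rainbow of size $k$ (a $k$-rainbow) with respect to $L$ is a set of $k$ covers $a_1\prec b_1,\dots,a_k\prec b_k$ of $P$ with $a_1<_L\cdots<_L a_k<_L b_k<_L\cdots<_L b_1$. The queue-number $\operatorname{qn}(P)$ is the smallest $k\geq 0$ such that there is a linear extension $L$ of $P$ with respect to which the covers of $P$ contain no $(k+1)$-rainbow. A diagram of $P$ represents the elements as distinct points in the plane and each cover $a\prec b$ as a $y$-monotone curve going upwards from $a$ to $b$ (not passing through points of other elements). A poset is planar if it admits a crossing-free diagram, i.e. one in which distinct curves meet only in common endpoints. *)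

(* Defs.v *)
From mathcomp Require Import all_boot all_order all_algebra.
From mathcomp Require Import boolp classical_sets set_interval reals.
From mathcomp Require Import topology normedtype.

Set Implicit Arguments.
Unset Strict Implicit.
Unset Printing Implicit Defensive.

Import Order.TTheory GRing.Theory Num.Theory.
Import numFieldNormedType.Exports.

Section Posets.
Context {d : Order.disp_t} {P : finPOrderType d}.
Implicit Types (a b x y : P) (L : rel P).

Definition covers a b : bool := (a < b)%O && ~~ [exists c, (a < c < b)%O].

(* As a relation, L is the strict linear order <_L. *)
Definition linear_extension L : Prop :=
  [/\ irreflexive L, transitive L,
      forall x y, x != y -> L x y || L y x
    & forall x y, (x < y)%O -> L x y].

(* The i-th pair of s is (a_i, b_i), so the sorted sequence is
   a_1, ..., a_k, b_k, ..., b_1. *)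
Definition rainbow L (k : nat) (s : seq (P * P)) : Prop :=
  [/\ size s = k, all (fun c => covers c.1 c.2) s
    & sorted L ([seq c.1 | c <- s] ++ rev [seq c.2 | c <- s])].

Definition queue_layout (k : nat) : Prop :=
  exists2 L, linear_extension L & ~ exists s, rainbow L k.+1 s.

Lemma linear_extension_exists : exists L, linear_extension L.
Proof.
pose w x := (#|[pred z | (z < x)%O]| * #|P| + enum_rank x)%N.
have rlt x : (enum_rank x < #|P|)%N by exact: ltn_ord.
have w_inj : injective w.
  move=> x y /(congr1 (modn^~ #|P|)); rewrite /w !modnMDl !modn_small //.
  by move/val_inj/enum_rank_inj.
exists (fun x y => w x < w y)%N; split.
- by move=> x; rewrite ltnn.
- by move=> y x z; exact: ltn_trans.
- by move=> x y; rewrite -neq_ltn; apply: contra => /eqP/w_inj ->.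
move=> x y xy.
have lt_xy : (#|[pred z | (z < x)%O]| < #|[pred z | (z < y)%O]|)%N.
  apply/proper_card/properP; split.
    by apply/fintype.subsetP => z; rewrite !inE => /lt_trans; exact.
  by exists x; rewrite !inE ?ltxx.
apply: (@leq_trans (#|[pred z | (z < x)%O]|.+1 * #|P|)%N).
  by rewrite /w mulSn addnC ltn_add2r.
by rewrite (leq_trans (leq_mul lt_xy (leqnn _))) // leq_addr.
Qed.

Lemma queue_layout_exists : exists k, `[< queue_layout k >].
Proof.
have [L LP] := linear_extension_exists; have [irr tr _ _] := LP.
exists #|P|; apply/asboolP; exists L => // -[s [ss _ srt]].
have : uniq ([seq c.1 | c <- s] ++ rev [seq c.2 | c <- s]).
  exact: (sorted_uniq tr irr srt).
rewrite cat_uniq => /andP[/card_uniqP us _].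
by have := max_card [in [seq c.1 | c <- s]]; rewrite us size_map ss ltnn.
Qed.

Definition queue_number : nat := ex_minn queue_layout_exists.

Definition height : nat :=
  \max_(A : {set P} | [forall x in A, forall y in A, (x >=< y)%O]) #|A|.

End Posets.

Arguments queue_number {d} P.
Arguments height {d} P.

Section Diagrams.
Local Open Scope classical_set_scope.
Local Open Scope ring_scope.
Variable R : realType.

Definition upward_curve (g : R -> R * R) (p q : R * R) : Prop :=
  [/\ {within `[0, 1]%classic, continuous g},
      {in `[0, 1] &, forall s t, s < t -> (g s).2 < (g t).2},
      g 0 = p & g 1 = q].

Variables (d : Order.disp_t) (P : finPOrderType d).

(* Values of the curve map at pairs that are not covers are irrelevant, as are
   values of the curves outside the unit interval. *)
Definition is_diagram (pt : P -> R * R) (curve : P -> P -> R -> R * R) : Prop :=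
  [/\ injective pt,
      forall a b, covers a b -> upward_curve (curve a b) (pt a) (pt b)
    & forall a b, covers a b -> forall t, t \in `[0, 1] ->
      forall c, curve a b t = pt c -> c = a \/ c = b].

Definition crossing_free (pt : P -> R * R) (curve : P -> P -> R -> R * R) :
    Prop :=
  forall a b c e, covers a b -> covers c e -> (a, b) <> (c, e) ->
  forall s t, s \in `[0, 1] -> t \in `[0, 1] -> curve a b s = curve c e t ->
  exists x, [/\ x = a \/ x = b, x = c \/ x = e & curve a b s = pt x].

Definition planar : Prop :=
  exists pt curve, is_diagram pt curve /\ crossing_free pt curve.

End Diagrams.

(* Main.v *)
Require Import Defs.
From mathcomp Require Import all_boot all_order all_algebra.
From mathcomp Require Import boolp classical_sets reals.
From mathcomp Require Import topology normedtype realfun.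

Set Implicit Arguments.
Unset Strict Implicit.
Unset Printing Implicit Defensive.

Import Order.TTheory GRing.Theory Num.Theory.
Import numFieldNormedType.Exports.

(** Heights grow strictly along the curves of a planar diagram, so each cover is
    drawn as the graph of a continuous function of the height, and a maximal
    chain from the minimum to the maximum is a continuous function on the whole
    range of heights. Since covers do not cross, two such chains can only agree
    at a height where they share an element or a cover; this is
    [maximal_chains_meet], and combined with the intermediate value theorem it
    is all the planarity that is needed.

    Two incomparable elements p and q lie on chains that do not meet between
    the heights of p and q, and the side on which one chain passes the other
    does not depend on the chains. This defines the relation p is left of q. It
    is transitive, and relates two distinct elements exactly when they are
    incomparable ([left_of_total], [left_of_trans]). Hence both (< or left of)
    and (< or right of) are linear extensions of P, with intersection <. Also,
    two ascending chains that exchange sides share an element on their way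
    ([left_of_crossing]); this replaces the fact that P is a lattice.

    The layout is L := (< or left of). Let a -< b and a' -< b' be nested
    covers: a <_L a' <_L b' <_L b. Either a < a' or a is left of a', and either
    b' < b or b' is left of b. Both comparabilities would put a' strictly
    inside the cover a -< b, and if both pairs are incomparable then the chains
    cross at an element strictly inside it. So exactly one of a < a', b' < b
    holds ([nested_covers]). In a rainbow with innermost cover a_k -< b_k, every
    other cover thus has its source below a_k or its target above b_k. Any two
    such sources are comparable, and so are any two such targets, again because
    otherwise two chains would cross strictly inside a cover
    ([nested_sources_chain], [nested_targets_chain]). These k - 1 elements form
    a chain together with a_k and b_k, so a rainbow of size k forces height at
    least k + 1. *)

(** * Rainbows and pairs of conjugate orders *)

Lemma pairwise_in (T : eqType) (r : rel T) (s : seq T) x y :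
  pairwise r s -> x \in s -> y \in s -> [\/ x = y, r x y | r y x].
Proof.
elim: s => // z s IHs /andP[/allP zs ps]; rewrite !inE.
move=> /predU1P[->|xs] /predU1P[->|ys]; first exact: Or31.
- by apply: Or32; exact: zs.
- by apply: Or33; exact: zs.
- exact: IHs.
Qed.

Section Conjugate.
Context {d : Order.disp_t} {P : finPOrderType d}.
Local Open Scope order_scope.
Implicit Types (left : rel P) (x y z : P).

(** Irreflexivity and asymmetry follow from the first and last conditions. *)
Definition conjugate_order left : Prop :=
  [/\ forall x y, left x y -> x >< y,
      forall x y, x >< y -> left x y || left y x
    & transitive left].

Definition left_extension left : rel P := fun x y => (x < y) || left x y.

Lemma conjugate_converse left : conjugate_order left ->
  conjugate_order (fun x y => left y x).
Proof.
move=> [inc tot tr]; split.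
- by move=> x y /inc; rewrite comparable_sym.
- by move=> x y /tot; rewrite orbC.
- by move=> y x z yx zy; exact: tr zy yx.
Qed.

(** If x < y and y is left of z, then z <= x would make y and z comparable, and
    if z were left of x it would follow that y is left of x; so x < z or x is
    left of z. The other mixed case is symmetric. *)
Lemma left_extension_linear left : conjugate_order left ->
  linear_extension (left_extension left).
Proof.
move=> [inc tot tr].
have left_irr x : left x x = false.
  by apply/negP => /inc; rewrite comparablexx.
have left_lt x y : left x y -> (x < y) || (y < x) = false.
  by move=> /inc; case: (comparableP x y).
rewrite /left_extension; split.
- by move=> x; rewrite /= ltxx left_irr.
- move=> y x z /= /orP[xy|xy] /orP[yz|yz].
  + by rewrite (lt_trans xy yz).
  + have [//|zx|xz|xz] := comparableP x z.
    * by have := left_lt _ _ yz; rewrite (lt_trans zx xy) orbT.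
    * have /orP[//|zx] : left x z || left z x by rewrite tot.
      by have := left_lt _ _ (tr _ _ _ yz zx); rewrite xy orbT.
    * by have := left_lt _ _ yz; rewrite -xz xy orbT.
  + have [//|zx|xz|xz] := comparableP x z.
    * by have := left_lt _ _ xy; rewrite (lt_trans yz zx) orbT.
    * have /orP[//|zx] : left x z || left z x by rewrite tot.
      by have := left_lt _ _ (tr _ _ _ zx xy); rewrite yz orbT.
    * by have := left_lt _ _ xy; rewrite xz yz orbT.
  + by rewrite (tr _ _ _ xy yz) orbT.
- move=> x y /= xy; have [//|_|xy_|xy_] := comparableP x y.
    by rewrite orbT.
    by rewrite /= tot.
  by rewrite xy_ eqxx in xy.
- by move=> x y /= ->.
Qed.

(** The two linear extensions form a realizer of <. *)
Lemma lt_left_extensions left x y : conjugate_order left ->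
    left_extension left x y ->
    left_extension (fun u v => left v u) x y ->
  x < y.
Proof.
move=> [inc _ tr] /orP[//|xy] /orP[//|yx].
by have := inc _ _ (tr _ _ _ xy yx); rewrite comparablexx.
Qed.

Lemma cover_interval x y z : covers x y -> x <= z -> z <= y -> z = x \/ z = y.
Proof.
move=> /andP[_ /existsPn/(_ z)] + xz zy.
rewrite !lt_neqAle xz zy !andbT negb_and !negbK.
by case/orP=> /eqP; [left|right].
Qed.

Variable left : rel P.
Hypothesis leftP : conjugate_order left.
(* Two ascending chains that exchange sides share an element. *)
Hypothesis crossing : forall a a' b b', left a a' -> left b' b ->
    a < b -> a < b' -> a' < b -> a' < b' ->
  exists z, [/\ a <= z, z <= b, a' <= z & z <= b'].

Let L := left_extension left.
Let L' := left_extension (fun x y => left y x).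

Let Ltr : transitive L.
Proof. by have [_ +] := left_extension_linear leftP. Qed.
Let L'tr : transitive L'.
Proof. by have [_ +] := left_extension_linear (conjugate_converse leftP). Qed.
Let Lirr : irreflexive L.
Proof. by have [+] := left_extension_linear leftP. Qed.
Let ltL x y : x < y -> L x y.
Proof. by rewrite /L /left_extension /= => ->. Qed.
Let ltL' x y : x < y -> L' x y.
Proof. by rewrite /L' /left_extension /= => ->. Qed.

Let cover_lt (a b : P) : covers a b -> a < b. Proof. by case/andP. Qed.

(** The crossing element would lie in the cover, hence be one of its ends, but
    a is incomparable to a' and b to b'. *)
Lemma cover_not_crossed (a b a' b' : P) :
  covers a b -> left a a' -> left b' b -> a < b' -> a' < b -> a' < b' -> False.
Proof.
move=> cab aa bb ab' a'b a'b'; have [inc _ _] := leftP.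
have [z [az zb a'z zb']] := crossing aa bb (cover_lt cab) ab' a'b a'b'.
have [za|zb_] := cover_interval cab az zb.
  by have := inc _ _ aa; rewrite /Order.comparable -za a'z orbT.
by have := inc _ _ bb; rewrite /Order.comparable -zb_ zb' orbT.
Qed.

(** For covers c and c' this means that c' lies under c in a rainbow: L extends
    <, so it also puts the source of c' before its target. *)
Definition nested : rel (P * P) := fun c c' => L c.1 c'.1 && L c'.2 c.2.

Lemma nested_covers (a b a' b' : P) : covers a b -> covers a' b' ->
    nested (a, b) (a', b') ->
  (a < a' /\ left b' b) \/ (left a a' /\ b' < b).
Proof.
move=> cab cab' /andP[/= aa bb].
have [ab ab'] := (cover_lt cab, cover_lt cab').
have [bb' |nbb] := boolP (b' < b).
  case/orP: (aa) => [aa'|]; last by right.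
  have [|a'a|a'b] := cover_interval cab (ltW aa') _.
  - by rewrite ltW // (lt_trans ab').
  - by rewrite a'a ltxx in aa'.
  - by have := lt_trans ab' bb'; rewrite a'b ltxx.
have {}nbb : left b' b by move: bb; rewrite /L /left_extension /= (negbTE nbb).
case/orP: (aa) => [aa'|aa']; first by left.
(* The realizer gives a < b' and a' < b: both pairs are in the right order for
   L by nesting, and in the converse order because a' precedes a, which
   precedes b, which precedes b'. *)
exfalso; apply: (cover_not_crossed cab aa' nbb) => //.
  apply: (lt_left_extensions leftP); first exact: (Ltr aa (ltL ab')).
  by apply: (L'tr (ltL' ab)); rewrite /L' /left_extension /= nbb orbT.
apply: (lt_left_extensions leftP); first exact: (Ltr (ltL ab') bb).
by apply: (L'tr _ (ltL' ab)); rewrite /L' /left_extension /= aa' orbT.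
Qed.

(** If a and a' were incomparable, then b' < b. As a < a'' the cover a -< b
    keeps a'' from being below b, so a'' is left of b: the chain from a to b and
    the one from a' to a'' exchange sides. *)
Lemma nested_sources_chain (a b a' b' a'' b'' : P) :
    covers a b -> covers a' b' -> covers a'' b'' ->
    nested (a, b) (a', b') -> nested (a', b') (a'', b'') ->
  a < a'' -> a' < a'' -> a < a'.
Proof.
move=> cab cab' cab'' n n' aa'' a'a''.
have [[//]|[aa' b'b]] := nested_covers cab cab' n.
have /orP[a''b|a''b] : L a'' b.
  case/andP: n' => /= _ b''b'.
  exact: Ltr (ltL (cover_lt cab'')) (Ltr b''b' (ltL b'b)).
- have [a''a|a''b_] := cover_interval cab (ltW aa'') (ltW a''b).
    by rewrite a''a ltxx in aa''.
  by rewrite a''b_ ltxx in a''b.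
exfalso; apply: (cover_not_crossed cab aa' a''b) => //.
exact: lt_trans (cover_lt cab') b'b.
Qed.

(** If b' and b were incomparable, then a < a'. As b'' < b the cover a -< b
    keeps b'' from being above a, so a is left of b'': the chain from a to b and
    the one from b'' to b' exchange sides. *)
Lemma nested_targets_chain (a b a' b' a'' b'' : P) :
    covers a b -> covers a' b' -> covers a'' b'' ->
    nested (a, b) (a', b') -> nested (a', b') (a'', b'') ->
  b'' < b -> b'' < b' -> b' < b.
Proof.
move=> cab cab' cab'' n n' b''b b''b'.
have [[aa' b'b]|[]//] := nested_covers cab cab' n.
have /orP[ab''|ab''] : L a b''.
  case/andP: n' => /= a'a'' _.
  exact: Ltr (Ltr (ltL aa') a'a'') (ltL (cover_lt cab'')).
- have [b''a|b''b_] := cover_interval cab (ltW ab'') (ltW b''b).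
    by rewrite b''a ltxx in ab''.
  by rewrite b''b_ ltxx in b''b.
exfalso; apply: (cover_not_crossed cab ab'' b'b) => //.
exact: lt_trans aa' (cover_lt cab').
Qed.

Lemma rainbow_pairwise k s : rainbow L k s -> pairwise nested s.
Proof.
move=> [_ _]; rewrite (sorted_pairwise Ltr) pairwise_cat => /and3P[_].
rewrite pairwise_map => fst_s.
rewrite -(sorted_pairwise Ltr) rev_sorted (sorted_pairwise); last first.
  by move=> y x z yx zy; exact: Ltr zy yx.
rewrite pairwise_map => snd_s.
by rewrite /nested (pairwise_relI (relpre fst L)) fst_s.
Qed.

(** Every cover contributes its source to a chain if that is at most the
    innermost source, and its target otherwise; the innermost target is one more
    element of this chain. *)
Lemma rainbow_height k s : rainbow L k.+1 s -> (k.+2 <= height P)%N.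
Proof.
move=> rs; have := rainbow_pairwise rs; case: rs => + /allP + _.
case/lastP: s => // s c0; rewrite size_rcons => -[sk] cov pw.
set s0 := rcons s c0 in cov pw.
have s0c0 : c0 \in s0 by rewrite mem_rcons mem_head.
have ab0 : c0.1 < c0.2 by exact/cover_lt/cov.
have inner c : c \in s0 -> c = c0 \/ nested c c0.
  move: pw; rewrite pairwise_rcons => /andP[/allP sc0 _].
  by rewrite mem_rcons inE => /predU1P[->|/sc0]; [left|right].
pose f (c : P * P) := if c.1 <= c0.1 then c.1 else c.2.
have fP c : c \in s0 ->
    (f c = c.1 /\ c.1 <= c0.1) \/ (f c = c.2 /\ c0.2 < c.2).
  rewrite /f => cs; case: ifPn => [c10|nc10]; [by left|right; split=> //].
  have [cc0|cc0] := inner _ cs; first by rewrite cc0 lexx in nc10.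
  move: cc0 (cov _ cs) (cov _ s0c0); case: c {cs} nc10 => a b /= nc10.
  case: (c0) nc10 => a0 b0 /= nc10 n cab cab0.
  by have [[/ltW]|[]//] := nested_covers cab cab0 n; rewrite (negbTE nc10).
have nested_neq c c' : c \in s0 -> c' \in s0 -> nested c c' -> f c != f c'.
  move=> cs cs' /andP[c1 c2]; apply/eqP.
  case: (fP _ cs) (fP _ cs') => [] [-> l] [] [-> l'] e.
  - by rewrite e Lirr in c1.
  - by have := le_lt_trans l (lt_trans ab0 l'); rewrite e ltxx.
  - by have := le_lt_trans l' (lt_trans ab0 l); rewrite e ltxx.
  - by rewrite e Lirr in c2.
have nested_comp c c' : c \in s0 -> c' \in s0 -> nested c c' -> f c >=< f c'.
  move=> cs cs' n.
  have [->|n'] := inner _ cs'.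
    case: (fP _ cs) (fP _ s0c0) => [] [-> l] [] [-> l'].
    - by rewrite /Order.comparable l.
    - by rewrite ltxx in l'.
    - by rewrite /Order.comparable (ltW (lt_trans ab0 l)) orbT.
    - by rewrite ltxx in l'.
  have n0 : nested c c0.
    case/andP: n => n1 n2; case/andP: n' => n3 n4.
    by rewrite /nested (Ltr n1 n3) (Ltr n4 n2).
  have lt1 e : nested e c0 -> e.1 <= c0.1 -> e.1 < c0.1.
    move=> /andP[e1 _]; rewrite le_eqVlt => /predU1P[ee|//].
    by rewrite ee Lirr in e1.
  case: (fP _ cs) (fP _ cs') => [] [-> l] [] [-> l'].
  - have := nested_sources_chain _ _ _ _ _ (lt1 _ n0 l) (lt1 _ n' l').
    move=> /(_ c.2 c'.2 c0.2).
    rewrite -!surjective_pairing !cov // => /(_ isT isT isT n n')/ltW.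
    by rewrite /Order.comparable => ->.
  - by rewrite /Order.comparable (ltW (le_lt_trans l (lt_trans ab0 l'))).
  - by rewrite /Order.comparable (ltW (le_lt_trans l' (lt_trans ab0 l))) orbT.
  - have := nested_targets_chain _ _ _ _ _ l l'.
    move=> /(_ c.1 c'.1 c0.1).
    rewrite -!surjective_pairing !cov // => /(_ isT isT isT n n')/ltW.
    by rewrite /Order.comparable => ->; rewrite orbT.
have f_inj : {in s0 &, injective f}.
  move=> c c' cs cs' e; have [//|n|n] := pairwise_in pw cs cs'.
    by have := nested_neq _ _ cs cs' n; rewrite e eqxx.
  by have := nested_neq _ _ cs' cs n; rewrite e eqxx.
have f_comp c c' : c \in s0 -> c' \in s0 -> f c >=< f c'.
  move=> cs cs'; have [->|n|n] := pairwise_in pw cs cs'.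
  - exact: comparablexx.
  - exact: nested_comp.
  - by rewrite comparable_sym; exact: nested_comp.
have f_top c : c \in s0 -> f c >=< c0.2 /\ f c != c0.2.
  move=> /fP[] [-> l].
    have lt := le_lt_trans l ab0.
    by rewrite (lt_eqF lt) /Order.comparable (ltW lt).
  by rewrite (gt_eqF l) /Order.comparable (ltW l) orbT.
have uniq_s0 : uniq s0.
  by apply: pairwise_uniq pw => c; rewrite /nested Lirr.
pose A := [set x in c0.2 :: map f s0].
have cardA : #|A| = k.+2.
  rewrite cardsE (card_uniqP _) /= ?size_map ?size_rcons ?sk //.
  rewrite map_inj_in_uniq // uniq_s0 andbT.
  by apply/mapP => -[c /f_top[_ /eqP ne]] e; case: ne.
rewrite /height -cardA; apply: (bigop.bigmax_sup A) => //.
apply/forall_inP => x; rewrite !inE => xs.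
apply/forall_inP => y; rewrite !inE => ys.
case/predU1P: xs => [->|/mapP[c cs ->]];
  case/predU1P: ys => [->|/mapP[c' cs' ->]].
- exact: comparablexx.
- by rewrite comparable_sym; have [] := f_top _ cs'.
- by have [] := f_top _ cs.
- exact: f_comp.
Qed.

Lemma queue_layout_height k : (height P <= k.+1)%N -> queue_layout (P := P) k.
Proof.
move=> hk; exists L; first exact: left_extension_linear.
by move=> [s /rainbow_height]; rewrite ltnNge hk.
Qed.
End Conjugate.

(** * Upward curves as graphs over the height *)

Section Graphs.
Local Open Scope classical_set_scope.
Local Open Scope ring_scope.
Variable R : realType.

Lemma within_continuous_comp_sub (A B : set R) (f g : R -> R) :
    (forall x, A x -> B (f x)) ->
    {within A, continuous f} -> {within B, continuous g} ->
  {within A, continuous (g \o f)}.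
Proof.
move=> AB cf cg; apply/subspace_continuousP => x Ax.
move/subspace_continuousP : cf => /(_ x Ax) cf.
move/subspace_continuousP : cg => /(_ _ (AB x Ax)) cg.
apply: (cvg_comp _ _ _ cg) => U /=.
rewrite /nbhs /= /within /= => nU.
have := cf _ nU; rewrite /nbhs /= /within /= => nV.
by near=> z => Az; apply: (near nV z) => //; exact: AB.
Unshelve. all: by end_near. Qed.

(** The second coordinate of the curve is strictly increasing, so it has a
    continuous inverse, the time as a function of the height; f is the first
    coordinate at that time. *)
Lemma upward_curve_graph (g : R -> R * R) (p q : R * R) : upward_curve g p q ->
  p.2 < q.2 /\ exists f : R -> R,
    [/\ {within `[p.2, q.2], continuous f}, f p.2 = p.1, f q.2 = q.1
      & forall y, y \in `[p.2, q.2] ->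
          exists2 t, t \in `[0, 1] & g t = (f y, y)].
Proof.
move=> [gcont gmono g0 g1].
have I0 : (0 : R) \in `[0, 1] by rewrite in_itv /= lexx ler01.
have I1 : (1 : R) \in `[0, 1] by rewrite in_itv /= lexx ler01.
have [gfst gsnd] : {within `[0, 1], continuous (fst \o g)} /\
    {within `[0, 1], continuous (snd \o g)}.
  split; apply: within_continuous_comp gcont => z _.
    exact: cvg_fst.
  exact: cvg_snd.
have inj : {in `[0, 1] &, injective (snd \o g)}.
  move=> s t sI tI /= gst; have [st|ts|//] := ltgtP s t.
    by have := gmono _ _ sI tI st; rewrite gst ltxx.
  by have := gmono _ _ tI sI ts; rewrite gst ltxx.
pose time y := xget 0 [set t | t \in `[0, 1] /\ (g t).2 = y].
have timeK : {in `[0, 1], cancel (snd \o g) time}.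
  move=> t tI; rewrite /time; case: xgetP => [u _ /= [uI gu]|/(_ t)].
    exact: inj.
  by move=> h; exfalso; apply: h.
have timeP y : y \in `[p.2, q.2] -> time y \in `[0, 1] /\ (g (time y)).2 = y.
  move=> yI; have [|t tI gty] := @IVT R (snd \o g) 0 1 y ler01 gsnd.
    have := gmono 0 1 I0 I1 ltr01; rewrite /= g0 g1 => /ltW pq.
    by rewrite (min_idPl pq) (max_idPr pq); rewrite in_itv in yI.
  by move: (timeK _ tI); rewrite gty => ->; rewrite -gty.
have time0 : time p.2 = 0 by rewrite -g0 (timeK _ I0).
have time1 : time q.2 = 1 by rewrite -g1 (timeK _ I1).
have timec : {within `[p.2, q.2], continuous time}.
  rewrite -g0 -g1.
  exact: (@segment_can_le_continuous R 0 1 (snd \o g) time ler01 gsnd timeK).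
split; first by rewrite -g0 -g1; exact: gmono.
exists ((fst \o g) \o time); split.
- by apply: within_continuous_comp_sub timec gfst => y /= /timeP[].
- by rewrite /= time0 g0.
- by rewrite /= time1 g1.
- move=> y /timeP[tI gy]; exists (time y) => //.
  by rewrite [LHS]surjective_pairing gy.
Qed.

Lemma continuous_curves_meet (f g : R -> R) (a b : R) : a <= b ->
    {within `[a, b], continuous f} -> {within `[a, b], continuous g} ->
    f a < g a -> g b < f b ->
  exists2 c, a <= c <= b & f c = g c.
Proof.
move=> ab fc gc fga gfb.
have [||c cab /eqP] := @IVT R (fun x => f x - g x) a b 0 ab.
- exact: (@within_continuousB _ _ _ _ f g).
- have fa : f a - g a <= 0 by rewrite subr_le0 ltW.
  have fb : 0 <= f b - g b by rewrite subr_ge0 ltW.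
  by rewrite ge_min fa le_max fb orbT.
by rewrite subr_eq0 => /eqP fgc; exists c => //; rewrite in_itv in cab.
Qed.
End Graphs.

Section Covers.
Context {d : Order.disp_t}.
Local Open Scope order_scope.

Lemma cover_path (P : finPOrderType d) (x y : P) : x <= y ->
  exists2 s, path covers x s & last x s = y.
Proof.
have [n] := ubnP #|[pred z | x <= z <= y]|.
elim: n x y => // n IHn x y; rewrite ltnS => size_xy.
rewrite le_eqVlt => /predU1P[<-|xy]; first by exists [::].
have [xcy|] := boolP (covers x y); first by exists [:: y]; rewrite //= xcy.
rewrite /covers xy negbK /= => /existsP[c /andP[xc cy]].
have [||s1 p1 l1] := IHn x c; last 1 first.
- have [||s2 p2 l2] := IHn c y; last 1 first.
  + by exists (s1 ++ s2); rewrite ?cat_path ?last_cat l1 ?p1.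
  + apply: leq_trans size_xy; apply/proper_card/properP; split.
      apply/fintype.subsetP => z; rewrite !inE => /andP[cz ->].
      by rewrite (le_trans (ltW xc)).
    by exists x; rewrite !inE ?lexx ?(ltW xy) // (lt_geF xc).
  + exact: ltW.
- apply: leq_trans size_xy; apply/proper_card/properP; split.
    apply/fintype.subsetP => z; rewrite !inE => /andP[-> zc].
    by rewrite (le_trans zc (ltW cy)).
  by exists y; rewrite !inE ?lexx ?(ltW xy) // (lt_geF cy) andbF.
- exact: ltW.
Qed.

Lemma cover_path_ge (P : finPOrderType d) (x y : P) s :
  path covers x s -> y \in x :: s -> x <= y.
Proof.
elim: s x => [|z s IHs] x /=; first by rewrite inE => _ /eqP->.
case/andP=> /andP[xz _] ps; rewrite inE => /predU1P[->//|ys].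
exact: le_trans (ltW xz) (IHs _ ps ys).
Qed.

(** The least element of the chain is left out of s. *)
Definition maximal_chain (P : finTBPOrderType d) (s : seq P) : bool :=
  path covers \bot s && (last \bot s == \top).

Lemma maximal_chain_through (P : finTBPOrderType d) (x y : P) : x <= y ->
  exists s, [/\ maximal_chain s, x \in \bot :: s & y \in \bot :: s].
Proof.
move=> xy.
have [s1 p1 l1] := cover_path (le0x x).
have [s2 p2 l2] := cover_path xy.
have [s3 p3 l3] := cover_path (lex1 y).
exists (s1 ++ s2 ++ s3); split.
- by rewrite /maximal_chain !cat_path !last_cat l1 l2 l3 p1 p2 p3 /=.
- by rewrite -cat_cons mem_cat -[x in x \in _]l1 mem_last.
have : y \in x :: s2 by rewrite -[y in y \in _]l2 mem_last.
rewrite -cat_cons !mem_cat inE => /predU1P[->|->]; last by rewrite orbT.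
by rewrite -[x in x \in _]l1 mem_last.
Qed.
End Covers.

Section Drawings.
Local Open Scope classical_set_scope.
Local Open Scope ring_scope.
Context {R : realType} {d : Order.disp_t}.

(** A planar diagram with the parametrization of its curves removed: X and Y
    are the coordinates of the elements, and [edge a b] is the abscissa of the
    curve of the cover (a, b) as a function of the height. *)
Definition graph_drawing (P : finPOrderType d)
    (X Y : P -> R) (edge : P -> P -> R -> R) : Prop :=
  [/\ forall a b, covers a b -> Y a < Y b,
      forall a b, covers a b -> {within `[Y a, Y b], continuous (edge a b)},
      forall a b, covers a b -> edge a b (Y a) = X a /\ edge a b (Y b) = X b
    & forall a b c e y, covers a b -> covers c e -> (a, b) <> (c, e) ->
        Y a <= y <= Y b -> Y c <= y <= Y e -> edge a b y = edge c e y ->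
      exists x, [/\ x = a \/ x = b, x = c \/ x = e & Y x = y]].

Lemma planar_graph_drawing (P : finPOrderType d) : planar R P ->
  exists X Y edge, @graph_drawing P X Y edge.
Proof.
move=> [pt [curve [[_ up _] nocross]]].
have /choice[edge edgeP] (ab : P * P) : exists f : R -> R, covers ab.1 ab.2 ->
    [/\ {within `[(pt ab.1).2, (pt ab.2).2], continuous f},
        f (pt ab.1).2 = (pt ab.1).1, f (pt ab.2).2 = (pt ab.2).1
      & forall y, y \in `[(pt ab.1).2, (pt ab.2).2] ->
          exists2 t, t \in `[0, 1] & curve ab.1 ab.2 t = (f y, y)].
  have [cab|ncab] := pselect (covers ab.1 ab.2); last by exists (fun=> 0).
  by have [_ [f ?]] := upward_curve_graph (up _ _ cab); exists f.
exists (fst \o pt), (snd \o pt), (fun a b => edge (a, b)); split => /=.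
- by move=> a b /up/upward_curve_graph[].
- by move=> a b cab; have [] := edgeP (a, b) cab.
- by move=> a b cab; have [] := edgeP (a, b) cab.
move=> a b c e y cab cce ne yab yce eqy.
have [_ _ _ /(_ y)[|t tI gt]] := edgeP (a, b) cab; first by rewrite in_itv.
have [_ _ _ /(_ y)[|u uI gu]] := edgeP (c, e) cce; first by rewrite in_itv.
have [|x [xab xce ptx]] := nocross _ _ _ _ cab cce ne t u tI uI.
  by rewrite gt gu eqy.
by exists x; rewrite -ptx gt.
Qed.

Variables (P : finTBPOrderType d) (X Y : P -> R) (edge : P -> P -> R -> R).
Hypothesis drawing : graph_drawing X Y edge.
Implicit Types (p q x z : P) (y : R) (s t : seq P).

Let Y_cover a b : covers a b -> Y a < Y b.
Proof. by case: drawing => + _ _ _; apply. Qed.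

Lemma height_path p s : path covers p s -> Y p <= Y (last p s).
Proof.
elim: s p => [|q s IHs] p //= /andP[/Y_cover pq /IHs].
exact/le_trans/ltW.
Qed.

Lemma height_le p q : (p <= q)%O -> Y p <= Y q.
Proof. by move=> /cover_path[s /height_path + <-]. Qed.

Lemma height_lt p q : (p < q)%O -> Y p < Y q.
Proof.
move=> pq; have [[|x s] /= + pl] := cover_path (ltW pq).
  by rewrite pl ltxx in pq.
by rewrite -pl => /andP[/Y_cover px /height_path]; exact: lt_le_trans.
Qed.

(** At the height of an inner element the curves of the two covers agree; above
    the end of the path the value is arbitrary. *)
Fixpoint path_curve (p : P) (s : seq P) (y : R) : R :=
  if s is q :: s' then
    if y <= Y q then edge p q y else path_curve q s' y
  else X p.

Lemma path_curve_elem p q s : path covers p s -> q \in p :: s ->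
  path_curve p s (Y q) = X q.
Proof.
have [_ _ ends _] := drawing.
elim: s p => [|x s IHs] p; first by rewrite inE => _ /eqP->.
move=> /= /andP[cpx ps]; rewrite inE => /predU1P[->|qs].
  by rewrite ltW ?Y_cover //; have [] := ends _ _ cpx.
have := cover_path_ge ps qs; rewrite le_eqVlt => /predU1P[<-|/height_lt xq].
  by rewrite lexx; have [] := ends _ _ cpx.
by rewrite leNgt xq /=; exact: IHs.
Qed.

Lemma path_curve_continuous p s : path covers p s ->
  {within `[Y p, Y (last p s)], continuous (path_curve p s)}.
Proof.
have [_ cont ends _] := drawing.
elim: s p => [|q s IHs] p /=.
  by move=> _; rewrite set_itv1; exact: continuous_subspace1.
move=> /andP[cpq ps].
apply: (@continuous_subspaceW _ _ _
    (`[Y p, Y q] `|` `[Y q, Y (last q s)])) => [y|].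
  rewrite /= !in_itv /= => /andP[-> ->]; rewrite andbT.
  by case: (leP y (Y q)) => [|/ltW]; [left|right].
apply: withinU_continuous.
- exact: interval_closed.
- exact: interval_closed.
- apply: subspace_eq_continuous (cont _ _ cpq) => y.
  by rewrite /from_subspace inE /= in_itv /= => /andP[_ ->].
apply: (@subspace_eq_continuous _ _ _ (path_curve q s)); last exact: IHs.
move=> y; rewrite /from_subspace inE /= in_itv /= => /andP[qy _].
case: leP => // yq.
have /eqP <- : Y q == y by rewrite eq_le qy.
by rewrite path_curve_elem ?mem_head //; have [_ ->] := ends _ _ cpq.
Qed.

(** The last clause is how a and b being consecutive on the path will be used:
    it needs no reference to positions in the path. *)
Lemma path_curve_edge p s y :
    path covers p s -> s != [::] -> Y p <= y <= Y (last p s) ->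
  exists a b, [/\ covers a b, Y a <= y <= Y b, path_curve p s y = edge a b y
    & forall q, q \in p :: s -> (q <= a)%O || (b <= q)%O].
Proof.
elim: s p => // x s IHs p /= /andP[cpx ps] _ /andP[py ys].
case: leP => [yx|xy].
  exists p, x; rewrite cpx py yx; split=> // q.
  by rewrite inE => /predU1P[->|/(cover_path_ge ps)->]; rewrite ?lexx ?orbT.
have [||a [b [cab yab eqy inab]]] := IHs x ps; last 1 first.
- exists a, b; split=> // q; rewrite inE => /predU1P[->|]; last exact: inab.
  have px : (p <= x)%O by case/andP: cpx => /ltW.
  have /orP[xa|bx] := inab x (mem_head _ _); first by rewrite (le_trans px xa).
  case/andP: yab => _ yb.
  by have := lt_le_trans xy (le_trans yb (height_le bx)); rewrite ltxx.
- by case: s ys {IHs ps} => //=; rewrite leNgt xy.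
- by rewrite ltW.
Qed.

(** An element z of a chain at height y separates the lower elements of the
    chain from the upper ones. If y is the height of a point inside a cover, the
    source of that cover plays the same role: in this form, common elements and
    common covers of two chains need not be distinguished. *)
Definition separates z y q : Prop :=
  (Y q <= y -> (q <= z)%O) /\ (y <= Y q -> (z <= q)%O).

Lemma vertex_separates a b z y q : covers a b -> z = a \/ z = b -> Y z = y ->
  (q <= a)%O || (b <= q)%O -> separates z y q.
Proof.
move=> /andP[ab _] + <-; have Yab := height_lt ab.
case=> -> /orP[qa|bq]; split => //.
- rewrite le_eqVlt in qa; case/predU1P: qa => [->//|/height_lt qa].
  by rewrite leNgt qa.
- move=> qa; have := le_lt_trans (le_trans (height_le bq) qa) Yab.
  by rewrite ltxx.
- by move=> _; rewrite (le_trans (ltW ab)).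
- by move=> _; rewrite (le_trans qa (ltW ab)).
- move=> bq; have := le_lt_trans (le_trans bq (height_le qa)) Yab.
  by rewrite ltxx.
- rewrite le_eqVlt in bq; case/predU1P: bq => [->//|/height_lt bq].
  by rewrite leNgt bq.
Qed.

Lemma edge_separates a b y q : covers a b -> Y a <= y < Y b ->
  (q <= a)%O || (b <= q)%O -> separates a y q.
Proof.
move=> /andP[ab _] /andP[ay yb] /orP[qa|bq]; split => //.
- move=> yq; move: qa; rewrite le_eqVlt => /predU1P[->//|/height_lt qa].
  by have := lt_le_trans qa (le_trans ay yq); rewrite ltxx.
- move=> qy; have := le_lt_trans (le_trans (height_le bq) qy) yb.
  by rewrite ltxx.
- by move=> _; rewrite (le_trans (ltW ab)).
Qed.

(** Where two chains meet, there is an element through which one can pass from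
    either chain to the other without going down. *)
Lemma maximal_chains_meet s t y : maximal_chain s -> maximal_chain t ->
    Y \bot%O <= y <= Y \top%O ->
    path_curve \bot%O s y = path_curve \bot%O t y ->
  exists z, forall q, (q \in \bot%O :: s) || (q \in \bot%O :: t) ->
    separates z y q.
Proof.
move=> /andP[ps /eqP ls] /andP[pt /eqP lt] yI meet.
have [s0|s0] := eqVneq s [::].
  exists \bot%O => q _; have bt : \bot%O = \top%O :> P by rewrite -ls s0.
  by split=> _; rewrite ?le0x // bt lex1.
have [t0|t0] := eqVneq t [::].
  exists \bot%O => q _; have bt : \bot%O = \top%O :> P by rewrite -lt t0.
  by split=> _; rewrite ?le0x // bt lex1.
have [|a [b [cab yab eqs sab]]] := path_curve_edge ps s0 (y := y).
  by rewrite ls.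
have [|c [e [cce yce eqt tce]]] := path_curve_edge pt t0 (y := y).
  by rewrite lt.
have [[ac be]|ne] := eqVneq (a, b) (c, e); last first.
  have [_ _ _ nocross] := drawing.
  have [|x [xab xce Yx]] := nocross _ _ _ _ y cab cce (elimN eqP ne) yab yce.
    by rewrite -eqs meet.
  exists x => q /orP[/sab|/tce].
    exact: vertex_separates.
  exact: vertex_separates.
subst c e; have {sab tce} stab q :
    (q \in \bot%O :: s) || (q \in \bot%O :: t) -> (q <= a)%O || (b <= q)%O.
  by case/orP=> [/sab|/tce].
have [yb|by_] := ltP y (Y b).
  exists a => q /stab; apply: edge_separates => //.
  by case/andP: yab => ->.
exists b => q /stab; apply: vertex_separates cab _ _; first by right.
by apply/eqP; rewrite eq_le by_; case/andP: yab => _ ->.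
Qed.

Definition between p q y : bool :=
  Num.min (Y p) (Y q) <= y <= Num.max (Y p) (Y q).

Let betweenE p q y :
  between p q y = (Y p <= y <= Y q) || (Y q <= y <= Y p).
Proof.
by rewrite /between ge_min le_max; case: (ltgtP (Y p) y); case: (ltgtP (Y q) y).
Qed.

Let between_range p q y : between p q y -> Y \bot%O <= y <= Y \top%O.
Proof.
have low r : Y \bot%O <= Y r by exact/height_le/le0x.
have high r : Y r <= Y \top%O by exact/height_le/lex1.
rewrite betweenE; case/orP=> /andP[ly yu];
  by rewrite (le_trans _ ly) // (le_trans yu).
Qed.

Lemma chain_curve_continuous s (a b : R) : maximal_chain s ->
    Y \bot%O <= a -> b <= Y \top%O ->
  {within `[a, b], continuous (path_curve \bot%O s)}.
Proof.
move=> /andP[/path_curve_continuous + /eqP ls] la ub; rewrite ls.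
apply: continuous_subspaceW => c; rewrite /= !in_itv /= => /andP[ac cb].
by rewrite (le_trans la ac) (le_trans cb ub).
Qed.

Lemma chain_curve_elem s q : maximal_chain s -> q \in \bot%O :: s ->
  path_curve \bot%O s (Y q) = X q.
Proof. by move=> /andP[ps _]; exact: path_curve_elem. Qed.

(** At a common point one could pass from the chain of the lower element to that
    of the higher one, so that p and q would be comparable. *)
Lemma incomparable_curves_disjoint s t p q y :
    maximal_chain s -> maximal_chain t ->
    p \in \bot%O :: s -> q \in \bot%O :: t -> (p >< q)%O -> between p q y ->
  path_curve \bot%O s y <> path_curve \bot%O t y.
Proof.
move=> sC tC ps qt pq bpq.
move=> /(maximal_chains_meet sC tC (between_range bpq))[z sep].
have [|pz zp] := sep p; first by rewrite ps.
have [|qz zq] := sep q; first by rewrite qt orbT.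
move: pq bpq; rewrite /Order.comparable betweenE => + /orP[] /andP[l u].
  by rewrite (le_trans (pz l) (zq u)).
by rewrite (le_trans (qz l) (zp u)) orbT.
Qed.

Lemma incomparable_curves_side s t p q y y' :
    maximal_chain s -> maximal_chain t ->
    p \in \bot%O :: s -> q \in \bot%O :: t -> (p >< q)%O ->
    between p q y -> between p q y' ->
    path_curve \bot%O s y < path_curve \bot%O t y ->
  path_curve \bot%O s y' < path_curve \bot%O t y'.
Proof.
move=> sC tC ps qt pq yI yI' sty.
have disj := incomparable_curves_disjoint sC tC ps qt pq.
have [//|tsy'|/disj//] :=
  ltgtP (path_curve \bot%O s y') (path_curve \bot%O t y').
have [ly yu] := andP (between_range yI).
have [ly' yu'] := andP (between_range yI').
have [yy'|/ltW y'y] := leP y y'.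
  have [c /andP[yc cy'] /disj[]] := continuous_curves_meet yy'
    (chain_curve_continuous sC ly yu') (chain_curve_continuous tC ly yu')
    sty tsy'.
  move: yI yI' => /andP[ly_ _] /andP[_ yu_].
  by rewrite /between (le_trans ly_ yc) (le_trans cy' yu_).
have [c /andP[yc cy'] /esym/disj[]] := continuous_curves_meet y'y
  (chain_curve_continuous tC ly' yu) (chain_curve_continuous sC ly' yu)
  tsy' sty.
move: yI yI' => /andP[_ yu_] /andP[ly_ _].
by rewrite /between (le_trans ly_ yc) (le_trans cy' yu_).
Qed.

(** A single chain through q is asked for; [left_ofP] shows that the choice of
    this chain, and of one through p, is irrelevant. *)
Definition left_of : rel P := fun p q => (p >< q)%O &&
  `[< exists s, [/\ maximal_chain s, q \in \bot%O :: s
                  & X p < path_curve \bot%O s (Y p)] >].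

Let between_l p q : between p q (Y p).
Proof. by rewrite /between ge_min le_max !lexx. Qed.

Let between_r p q : between p q (Y q).
Proof. by rewrite /between ge_min le_max !lexx !orbT. Qed.

Lemma left_ofP p q s t y : left_of p q ->
    maximal_chain s -> p \in \bot%O :: s ->
    maximal_chain t -> q \in \bot%O :: t -> between p q y ->
  path_curve \bot%O s y < path_curve \bot%O t y.
Proof.
move=> /andP[pq /asboolP[r [rC qr Xp]]] sC ps tC qt yI.
apply: (incomparable_curves_side sC tC ps qt pq (between_r p q) yI).
rewrite (chain_curve_elem tC qt) -(chain_curve_elem rC qr).
apply: (incomparable_curves_side sC rC ps qr pq (between_l p q)).
  exact: between_r.
by rewrite (chain_curve_elem sC ps).
Qed.

Let through p : exists s, maximal_chain s /\ p \in \bot%O :: s.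
Proof. by have [s [? ? _]] := maximal_chain_through (lexx p); exists s. Qed.

Lemma left_of_total p q : (p >< q)%O -> left_of p q || left_of q p.
Proof.
move=> pq; have [s [sC ps]] := through p; have [t [tC qt]] := through q.
have := incomparable_curves_disjoint sC tC ps qt pq (between_l p q).
have [lt_st _|lt_ts _|//] :=
  ltgtP (path_curve \bot%O s (Y p)) (path_curve \bot%O t (Y p)).
  apply/orP; left; rewrite /left_of pq; apply/asboolP; exists t; split=> //.
  by rewrite -(chain_curve_elem sC ps).
have qp : (q >< p)%O by rewrite comparable_sym.
apply/orP; right; rewrite /left_of qp; apply/asboolP; exists s; split=> //.
rewrite -(chain_curve_elem tC qt).
apply: (incomparable_curves_side tC sC qt ps qp _ _ lt_ts).
  exact: between_r.
exact: between_l.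
Qed.

(** If x and z were comparable, a chain through both would pass y on both sides.
    If z were left of x, then at the height that is the median of the three,
    which lies between the heights of any two of them, chains through x, y and z
    would be cyclically ordered. *)
Lemma left_of_trans : transitive left_of.
Proof.
move=> y x z xy yz.
have [t [tC yt]] := through y.
have between_side u v w s : maximal_chain s -> u \in \bot%O :: s ->
    v \in \bot%O :: s -> left_of u w -> left_of w v -> False.
  move=> sC us vs uw wv.
  have [r [rC wr]] := through w.
  have := left_ofP uw sC us rC wr (between_r u w).
  by rewrite ltNge ltW // (left_ofP wv rC wr sC vs (between_l w v)).
have xz : (x >< z)%O.
  rewrite /Order.comparable; apply/negP => /orP[].
    by case/maximal_chain_through=> s [sC xs zs]; apply: (between_side x z y s).
  by case/maximal_chain_through=> s [sC zs xs]; apply: (between_side x z y s).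
case/orP: (left_of_total xz) => // zx.
have [s [sC xs]] := through x; have [r [rC zr]] := through z.
have cyc h : between x y h -> between y z h -> between z x h -> False.
  move=> hxy hyz hzx.
  have := lt_trans (left_ofP xy sC xs tC yt hxy) (left_ofP yz tC yt rC zr hyz).
  by rewrite ltNge ltW // (left_ofP zx rC zr sC xs hzx).
exfalso.
have [xy_|/ltW yx_] := leP (Y x) (Y y); have [yz_|/ltW zy_] := leP (Y y) (Y z).
- by apply: (cyc (Y y)); rewrite ?between_l ?between_r // betweenE xy_ yz_ orbT.
- have [xz_|/ltW zx_] := leP (Y x) (Y z).
    by apply: (cyc (Y z)); rewrite ?between_l ?between_r // betweenE xz_ zy_.
  by apply: (cyc (Y x)); rewrite ?between_l ?between_r // betweenE xy_ zx_ orbT.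
- have [xz_|/ltW zx_] := leP (Y x) (Y z).
    by apply: (cyc (Y x)); rewrite ?between_l ?between_r // betweenE yx_ xz_.
  by apply: (cyc (Y z)); rewrite ?between_l ?between_r // betweenE yz_ zx_ orbT.
- by apply: (cyc (Y y)); rewrite ?between_l ?between_r // betweenE yx_ zy_.
Qed.

(** Between the higher of a, a' and the lower of b, b', the chains through a, b
    and through a', b' exchange sides, so they meet; as all four comparabilities
    hold, this range of heights is not empty. *)
Lemma left_of_crossing a a' b b' : left_of a a' -> left_of b' b ->
    (a < b)%O -> (a < b')%O -> (a' < b)%O -> (a' < b')%O ->
  exists z, [/\ (a <= z)%O, (z <= b)%O, (a' <= z)%O & (z <= b')%O].
Proof.
move=> aa bb ab ab' a'b a'b'.
have [s [sC as_ bs]] := maximal_chain_through (ltW ab).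
have [t [tC a't b't]] := maximal_chain_through (ltW a'b').
pose u := Num.max (Y a) (Y a'); pose v := Num.min (Y b) (Y b').
have uv : u <= v by rewrite /u /v ge_max !le_min !height_le ?ltW.
have ul : between a a' u.
  by rewrite /between lexx ge_min le_max lexx.
have vl : between b' b v.
  by rewrite /between /v minC lexx le_max !ge_min !lexx orbT.
have [lu _] := andP (between_range ul); have [_ uv'] := andP (between_range vl).
have [c /andP[uc cv] meet] := continuous_curves_meet uv
  (chain_curve_continuous sC lu uv') (chain_curve_continuous tC lu uv')
  (left_ofP aa sC as_ tC a't ul) (left_ofP bb tC b't sC bs vl).
have cI : Y \bot%O <= c <= Y \top%O.
  by rewrite (le_trans lu uc) (le_trans cv uv').
have [z sep] := maximal_chains_meet sC tC cI meet.
move: uc cv; rewrite /u /v ge_max le_min => /andP[ac a'c] /andP[cb cb'].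
exists z; split.
- by apply: (sep a _).1 ac; rewrite as_.
- by apply: (sep b _).2 cb; rewrite bs.
- by apply: (sep a' _).1 a'c; rewrite a't orbT.
- by apply: (sep b' _).2 cb'; rewrite b't orbT.
Qed.
End Drawings.

(** * The theorem *)

Theorem theorem4 (R : realType) (h : nat) (hh : (1 <= h)%N)
    (d : Order.disp_t) (P : finTBPOrderType d)
    (hP : height P = h) (planarP : planar R P) :
  (queue_number P <= h - 1)%N.
Proof.
have [X [Y [edge drawing]]] := planar_graph_drawing planarP.
have conj : conjugate_order (left_of X Y edge).
  split; first by move=> p q /andP[].
    exact: left_of_total drawing.
  exact: left_of_trans drawing.
rewrite /queue_number; case: ex_minnP => m _; apply; apply/asboolP.
apply: (queue_layout_height conj (left_of_crossing drawing)).
by rewrite hP subn1 prednK.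
Qed.
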